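(* Let $H_1, H_2, H_3$ be three complex Hilbert spaces. Let $W_i \in \mathcal{B}(H_i)$, $1 \leq i \leq 3$, be three contractions, let $A_1 \in \mathcal{B}(H_2,H_1)$, $A_2 \in \mathcal{B}(H_3,H_2)$, $B \in \mathcal{B}(H_3,H_1)$, and denote $$T=\begin{bmatrix} W_1 & A_1 & B \\ 0 & W_2 & A_2 \\ 0 & 0 & W_3 \end{bmatrix} \in \mathcal{B}(H_1 \oplus H_2 \oplus H_3).$$ Assume that $\|W_2\| < 1$. Then $T$ is a contraction if and only if there exist three contractions $V_1 \in \mathcal{B}(H_2,H_1)$, $V_2 \in \mathcal{B}(H_3,H_2)$, $V_3 \in \mathcal{B}(H_3,H_1)$ such that $$A_1 = D_{W_1^*}V_1D_{W_2},$$ $$A_2 = D_{W_2^*}V_2D_{W_3},$$ $$B = \left[D_{W_1^*}(\mathrm{Id}-V_1V_1^* )D_{W_1^*} \right]^{1/2} V_3 \left[ D_{W_3}(\mathrm{Id} - V_2^*V_2)D_{W_3} \right]^{1/2} - D_{W_1^*}V_1W_2^*V_2D_{W_3}.$$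
   Context: $\mathcal{B}(H,K)$ denotes the bounded linear operators from $H$ to $K$, and $\mathcal{B}(H)=\mathcal{B}(H,H)$. A contraction is an operator $T$ with $\|T\|\le 1$ (operator norm). For a contraction $T$, its defect operator is $D_T=(\mathrm{Id}-T^*T)^{1/2}$ (positive square root), where $\mathrm{Id}$ is the identity operator; thus $D_{T^*}=(\mathrm{Id}-TT^* )^{1/2}$. Direct sums of Hilbert spaces are orthogonal (Hilbertian) direct sums. *)

(* Defs.v *)
From HB Require Import structures.
From mathcomp Require Import all_boot all_order all_algebra ring.
From mathcomp Require Import all_classical reals topology normedtype.
From mathcomp Require Import complex.

Set Implicit Arguments.
Unset Strict Implicit.
Unset Printing Implicit Defensive.

Import Order.TTheory GRing.Theory Num.Theory.
Import numFieldNormedType.Exports.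

Local Open Scope classical_set_scope.
Local Open Scope ring_scope.

(* Complex Hilbert spaces. With {dot _ for conj} the inner product is linear
   in its first argument and conjugate-linear in the second one. The norm of
   a normedModType R[i] takes its (nonnegative real) values in R[i]. *)
HB.mixin Record isHilbert (R : realType) H of CompleteNormedModule R[i] H := {
  inner : {dot H for Num.conj};
  inner_normE : forall x : H, `|x| ^+ 2 = inner x x
}.

#[short(type="hilbertType")]
HB.structure Definition Hilbert (R : realType) :=
  {H of CompleteNormedModule R[i] H & isHilbert R H}.

Notation "'[ x , y ]" := (inner x y) (format "''[' x ,  y ]") : ring_scope.

Record bounded_op (R : realType) (H K : hilbertType R) := BoundedOp {
  op_fun :> H -> K;
  op_linear : linear op_fun;
  op_bounded : exists M : R[i], forall x, `|op_fun x| <= M * `|x|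
}.

Notation "''B' ( H , K )" := (bounded_op H K)
  (format "''B' ( H ,  K )") : type_scope.
Notation "''B' ( H )" := (bounded_op H H)
  (format "''B' ( H )") : type_scope.

HB.instance Definition _ (R : realType) (H K : hilbertType R) (T : 'B(H, K)) :=
  GRing.isLinear.Build R[i] H K _ (op_fun T) (op_linear T).

Lemma op_ext (R : realType) (H K : hilbertType R) (S T : 'B(H, K)) :
  S =1 T -> S = T.
Proof.
case: S T => [f fl fb] [g gl gb] /= /funext fg; move: fl fb gl gb.
by rewrite fg => *; congr BoundedOp; exact: Prop_irrelevance.
Qed.

HB.instance Definition _ (R : realType) (H K : hilbertType R) :=
  gen_eqMixin 'B(H, K).
HB.instance Definition _ (R : realType) (H K : hilbertType R) :=
  gen_choiceMixin 'B(H, K).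

Section op_algebra.
Context {R : realType}.
Implicit Types H K L : hilbertType R.

Lemma op_bound_ge0 H K (T : 'B(H, K)) :
  exists2 M : R[i], 0 <= M & forall x, `|T x| <= M * `|x|.
Proof.
have [M MT] := op_bounded T; exists `|M| => // x.
have Mx0 : 0 <= M * `|x| by apply: le_trans (MT x).
by rewrite -[`|x|]normr_id -normrM ger0_norm.
Qed.

Fact zero_op_linear H K : linear (fun _ : H => 0 : K).
Proof. by move=> a x y; rewrite scaler0 addr0. Qed.

Fact zero_op_bounded H K :
  exists M : R[i], forall x : H, `|0 : K| <= M * `|x|.
Proof. by exists 0 => x; rewrite normr0 mul0r. Qed.

Definition op0 H K := BoundedOp (@zero_op_linear H K) (@zero_op_bounded H K).

Fact opp_op_linear H K (T : 'B(H, K)) : linear (fun x => - T x).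
Proof. by move=> a x y; rewrite linearP opprD scalerN. Qed.

Fact opp_op_bounded H K (T : 'B(H, K)) :
  exists M : R[i], forall x, `|- T x| <= M * `|x|.
Proof. by have [M MT] := op_bounded T; exists M => x; rewrite normrN. Qed.

Definition op_opp H K (T : 'B(H, K)) :=
  BoundedOp (opp_op_linear T) (opp_op_bounded T).

Fact add_op_linear H K (S T : 'B(H, K)) : linear (fun x => S x + T x).
Proof. by move=> a x y; rewrite !linearP scalerDr addrACA. Qed.

Fact add_op_bounded H K (S T : 'B(H, K)) :
  exists M : R[i], forall x, `|S x + T x| <= M * `|x|.
Proof.
have [M MS] := op_bounded S; have [N NT] := op_bounded T; exists (M + N) => x.
by rewrite mulrDl (le_trans (ler_normD _ _))// lerD.
Qed.

Definition op_add H K (S T : 'B(H, K)) :=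
  BoundedOp (add_op_linear S T) (add_op_bounded S T).

Fact op_addA H K : associative (@op_add H K).
Proof. by move=> S T U; apply: op_ext => x /=; rewrite addrA. Qed.

Fact op_addC H K : commutative (@op_add H K).
Proof. by move=> S T; apply: op_ext => x /=; rewrite addrC. Qed.

Fact op_add0 H K : left_id (op0 H K) (@op_add H K).
Proof. by move=> S; apply: op_ext => x /=; rewrite add0r. Qed.

Fact op_addN H K : left_inverse (op0 H K) (@op_opp H K) (@op_add H K).
Proof. by move=> S; apply: op_ext => x /=; rewrite addNr. Qed.

HB.instance Definition _ H K := GRing.isZmodule.Build 'B(H, K)
  (@op_addA H K) (@op_addC H K) (@op_add0 H K) (@op_addN H K).

Fact id_op_linear H : linear (fun x : H => x).
Proof. by []. Qed.

Fact id_op_bounded H : exists M : R[i], forall x : H, `|x| <= M * `|x|.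
Proof. by exists 1 => x; rewrite mul1r. Qed.

Definition op_id H := BoundedOp (@id_op_linear H) (@id_op_bounded H).

Fact comp_op_linear H K L (S : 'B(K, L)) (T : 'B(H, K)) :
  linear (fun x => S (T x)).
Proof. by move=> a x y; rewrite !linearP. Qed.

Fact comp_op_bounded H K L (S : 'B(K, L)) (T : 'B(H, K)) :
  exists M : R[i], forall x, `|S (T x)| <= M * `|x|.
Proof.
have [M M0 MS] := op_bound_ge0 S; have [N NT] := op_bounded T.
by exists (M * N) => x; rewrite (le_trans (MS _))// -mulrA ler_wpM2l.
Qed.

Definition op_comp H K L (S : 'B(K, L)) (T : 'B(H, K)) :=
  BoundedOp (comp_op_linear S T) (comp_op_bounded S T).

End op_algebra.

Notation "'Id" := (op_id _) (at level 0, format "''Id'") : ring_scope.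
Notation "S '*o' T" := (op_comp S T)
  (at level 40, left associativity, format "S  *o  T") : ring_scope.

Section op_defs.
Context {R : realType}.
Implicit Types H K : hilbertType R.

(* Re turns `|T x|, a real element of R[i], into an element of R. *)
Definition opnorm H K (T : 'B(H, K)) : R :=
  sup [set complex.Re `|T x| | x in [set x | `|x| <= 1]].

Definition contraction_op H K (T : 'B(H, K)) : Prop := opnorm T <= 1.

(* Exists and is unique by the Riesz representation theorem; 0 is only the
   default value of xget. *)
Definition adjoint H K (T : 'B(H, K)) : 'B(K, H) :=
  xget 0 [set S : 'B(K, H) | forall x y, '[T x, y] = '[x, S y]].

(* The order of R[i] makes '[T x, x] a nonnegative real number. *)
Definition positive_op H (T : 'B(H)) : Prop := forall x, 0 <= '[T x, x].

(* The positive square root of T, which exists and is unique when T is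
   positive. *)
Definition op_sqrt H (T : 'B(H)) : 'B(H) :=
  xget 0 [set S : 'B(H) | positive_op S /\ S *o S = T].

End op_defs.

Notation "T ^*o" := (adjoint T) (at level 2, format "T ^*o") : ring_scope.

Definition defect (R : realType) (H K : hilbertType R) (T : 'B(H, K)) : 'B(H) :=
  op_sqrt ('Id - T^*o *o T).

(* An alias of H * K, because the product type already carries the sup norm. *)
Definition hsum (R : realType) (H K : hilbertType R) : Type := (H * K)%type.

Notation "H \oplus K" := (hsum H K)
  (at level 55, right associativity) : type_scope.

Section hsum.
Context {R : realType} (H K : hilbertType R).
Local Notation HK := (H \oplus K).

HB.instance Definition _ := GRing.Lmodule.copy HK (H * K)%type.

Definition hsum_norm (x : HK) : R[i] := sqrtC (`|x.1| ^+ 2 + `|x.2| ^+ 2).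

Definition hsum_inner (x y : HK) : R[i] := '[x.1, y.1] + '[x.2, y.2].

Let sqr_ge0 (x : HK) : 0 <= `|x.1| ^+ 2 + `|x.2| ^+ 2.
Proof. by rewrite addr_ge0 ?exprn_ge0. Qed.

Fact ler_hsum_normD (x y : HK) : hsum_norm (x + y) <= hsum_norm x + hsum_norm y.
Proof.
have [nx ny] : 0 <= hsum_norm x /\ 0 <= hsum_norm y by rewrite !sqrtC_ge0.
rewrite -ler_sqr ?nnegrE ?addr_ge0 ?sqrtC_ge0//.
rewrite sqrrD !sqrtCK.
set a := `|x.1|; set b := `|x.2|; set c := `|y.1|; set d := `|y.2|.
have [a0 b0 c0 d0] : [/\ 0 <= a, 0 <= b, 0 <= c & 0 <= d].
  by split; exact: normr_ge0.
apply: (@le_trans _ _ ((a + c) ^+ 2 + (b + d) ^+ 2)).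
  by rewrite lerD// ler_sqr ?nnegrE ?addr_ge0// ler_normD.
have -> : (a + c) ^+ 2 + (b + d) ^+ 2 =
    (a ^+ 2 + b ^+ 2) + (a * c + b * d) *+ 2 + (c ^+ 2 + d ^+ 2) by ring.
rewrite lerD2r lerD2l lerMn2r /=.
rewrite -ler_sqr ?nnegrE ?mulr_ge0 ?addr_ge0 ?mulr_ge0 ?sqrtC_ge0//.
rewrite exprMn !sqrtCK -subr_ge0.
have -> : (a ^+ 2 + b ^+ 2) * (c ^+ 2 + d ^+ 2) - (a * c + b * d) ^+ 2 =
    (a * d - b * c) ^+ 2 by ring.
by rewrite -realEsqr rpredB// ger0_real// mulr_ge0.
Qed.

Fact hsum_normZ (l : R[i]) (x : HK) : hsum_norm (l *: x) = `|l| * hsum_norm x.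
Proof.
rewrite /hsum_norm !normrZ !exprMn -mulrDr sqrtCM ?qualifE//= ?exprn_ge0//.
by rewrite sqrCK.
Qed.

Fact hsum_norm_eq0 (x : HK) : hsum_norm x = 0 -> x = 0.
Proof.
move=> /eqP; rewrite sqrtC_eq0 paddr_eq0 ?exprn_ge0//.
rewrite !expf_eq0 /= !normr_eq0 => /andP[/eqP x1 /eqP x2].
by case: x x1 x2 => /= ? ? -> ->.
Qed.

HB.instance Definition _ := Lmodule_isNormed.Build R[i] HK
  ler_hsum_normD hsum_normZ hsum_norm_eq0.

Lemma hsum_normE (x : HK) : `|x| ^+ 2 = `|x.1| ^+ 2 + `|x.2| ^+ 2.
Proof. by rewrite sqrtCK. Qed.

Lemma ler_hsum_norm1 (x : HK) : `|x.1| <= `|x|.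
Proof. by rewrite -ler_sqr ?nnegrE// hsum_normE lerDl exprn_ge0. Qed.

Lemma ler_hsum_norm2 (x : HK) : `|x.2| <= `|x|.
Proof. by rewrite -ler_sqr ?nnegrE// hsum_normE lerDr exprn_ge0. Qed.

Lemma ler_hsum_norm (x : HK) : `|x| <= `|x.1| + `|x.2|.
Proof.
rewrite -ler_sqr ?nnegrE ?addr_ge0// hsum_normE sqrrD -addrA lerD2l.
by rewrite lerDr mulrn_wge0// mulr_ge0.
Qed.

Fact hsum_complete (F : set_system HK) : ProperFilter F -> cauchy F -> cvg F.
Proof.
move=> FF /cauchyP Fc.
have [x Fx] : exists x : H, fst @ F --> x.
  apply/cvg_ex; apply: cauchy_cvg; apply/cauchyP => e e0; have [z Fz] := Fc e e0.
  exists z.1; change (F (fst @^-1` ball z.1 e)).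
  apply: filterS Fz => w; rewrite -!ball_normE /=.
  by apply: le_lt_trans; exact: (ler_hsum_norm1 ((z : HK) - w)).
have [y Fy] : exists y : K, snd @ F --> y.
  apply/cvg_ex; apply: cauchy_cvg; apply/cauchyP => e e0; have [z Fz] := Fc e e0.
  exists z.2; change (F (snd @^-1` ball z.2 e)).
  apply: filterS Fz => w; rewrite -!ball_normE /=.
  by apply: le_lt_trans; exact: (ler_hsum_norm2 ((z : HK) - w)).
apply/cvg_ex; exists ((x, y) : HK).
apply/cvgrPdist_lt => e e0.
have e20 : 0 < e / 2 by rewrite divr_gt0.
near=> z.
apply: le_lt_trans (ler_hsum_norm _) _; rewrite [e]splitr ltrD//=.
  by near: z; move/cvgrPdist_lt : Fx; apply.
by near: z; move/cvgrPdist_lt : Fy; apply.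
Unshelve. all: by end_near. Qed.

HB.instance Definition _ := Uniform_isComplete.Build HK hsum_complete.

Fact hsum_inner_bilinear :
  bilinear_for *%R (Num.conj \; *%R) hsum_inner.
Proof.
split=> [y|x] a u v; rewrite /hsum_inner /=.
  by rewrite !linearPl mulrDr addrACA.
by rewrite !linearPr mulrDr addrACA.
Qed.

HB.instance Definition _ :=
  bilinear_isBilinear.Build R[i] HK HK R[i] *%R (Num.conj \; *%R) hsum_inner
    hsum_inner_bilinear.

Fact hsum_inner_herm (x y : HK) :
  hsum_inner x y = (-1) ^+ false * (hsum_inner y x)^*.
Proof.
rewrite /hsum_inner rmorphD mulrDr; congr (_ + _); exact: hermC.
Qed.

HB.instance Definition _ :=
  isHermitianSesquilinear.Build R[i] HK false Num.conj hsum_inner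
    hsum_inner_herm.

Fact hsum_inner_normE (x : HK) : `|x| ^+ 2 = hsum_inner x x.
Proof. by rewrite hsum_normE /hsum_inner !inner_normE. Qed.

Fact hsum_inner_gt0 (x : HK) : x != 0 -> 0 < hsum_inner x x.
Proof. by move=> x0; rewrite -hsum_inner_normE exprn_gt0// normr_gt0. Qed.

HB.instance Definition _ :=
  isDotProduct.Build R[i] HK hsum_inner hsum_inner_gt0.

HB.instance Definition _ := isHilbert.Build R HK hsum_inner_normE.

End hsum.

Section opmx3.
Context {R : realType} (H1 H2 H3 K1 K2 K3 : hilbertType R)
  (T11 : 'B(H1, K1)) (T12 : 'B(H2, K1)) (T13 : 'B(H3, K1))
  (T21 : 'B(H1, K2)) (T22 : 'B(H2, K2)) (T23 : 'B(H3, K2))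
  (T31 : 'B(H1, K3)) (T32 : 'B(H2, K3)) (T33 : 'B(H3, K3)).

Definition opmx3_fun (x : H1 \oplus H2 \oplus H3) : K1 \oplus K2 \oplus K3 :=
  let: (x1, (x2, x3)) := x in
  (T11 x1 + T12 x2 + T13 x3,
  (T21 x1 + T22 x2 + T23 x3,
   T31 x1 + T32 x2 + T33 x3)).

Let row_linear (L : hilbertType R)
    (S1 : 'B(H1, L)) (S2 : 'B(H2, L)) (S3 : 'B(H3, L)) a x1 x2 x3 y1 y2 y3 :
  S1 (a *: x1 + y1) + S2 (a *: x2 + y2) + S3 (a *: x3 + y3) =
  a *: (S1 x1 + S2 x2 + S3 x3) + (S1 y1 + S2 y2 + S3 y3).
Proof.
by rewrite !linearP !scalerDr [RHS]addrACA; congr (_ + _); rewrite addrACA.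
Qed.

Fact opmx3_linear : linear opmx3_fun.
Proof.
move=> a [x1 [x2 x3]] [y1 [y2 y3]].
by congr (_, (_, _)); exact: row_linear.
Qed.

Let row_bounded (L : hilbertType R)
    (S1 : 'B(H1, L)) (S2 : 'B(H2, L)) (S3 : 'B(H3, L)) :
  exists M : R[i], forall x : H1 \oplus H2 \oplus H3,
    `|S1 x.1 + S2 x.2.1 + S3 x.2.2| <= M * `|x|.
Proof.
have [M1 M1_ge0 bM1] := op_bound_ge0 S1.
have [M2 M2_ge0 bM2] := op_bound_ge0 S2.
have [M3 M3_ge0 bM3] := op_bound_ge0 S3.
exists (M1 + M2 + M3) => x; rewrite !mulrDl.
have x2 := ler_hsum_norm2 x.
rewrite (le_trans (ler_normD _ _))// lerD//.
  rewrite (le_trans (ler_normD _ _))// lerD//.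
    by rewrite (le_trans (bM1 _))// ler_wpM2l// ler_hsum_norm1.
  by rewrite (le_trans (bM2 _))// ler_wpM2l// (le_trans (ler_hsum_norm1 _)).
by rewrite (le_trans (bM3 _))// ler_wpM2l// (le_trans (ler_hsum_norm2 _)).
Qed.

Fact opmx3_bounded : exists M : R[i], forall x, `|opmx3_fun x| <= M * `|x|.
Proof.
have [M1 bM1] := row_bounded T11 T12 T13.
have [M2 bM2] := row_bounded T21 T22 T23.
have [M3 bM3] := row_bounded T31 T32 T33.
exists (M1 + (M2 + M3)) => x; rewrite !mulrDl.
apply: le_trans (ler_hsum_norm _) _; apply: lerD.
  by case: x => x1 [x2 x3]; exact: (bM1 (x1, (x2, x3))).
apply: le_trans (ler_hsum_norm _) _; apply: lerD.
  by case: x => x1 [x2 x3]; exact: (bM2 (x1, (x2, x3))).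
by case: x => x1 [x2 x3]; exact: (bM3 (x1, (x2, x3))).
Qed.

Definition opmx3 : 'B(H1 \oplus H2 \oplus H3, K1 \oplus K2 \oplus K3) :=
  BoundedOp opmx3_linear opmx3_bounded.

End opmx3.

(* Main.v *)
Require Import Defs.
From mathcomp Require Import all_boot all_order all_algebra.
From mathcomp Require Import all_classical reals topology normedtype.
From mathcomp Require Import complex ring lra.

Import Order.TTheory GRing.Theory Num.Theory.
Local Open Scope ring_scope.

(** The theorem says when the missing corner of a contraction can be filled in.

Suppose A1 = L D and A2 = D' K, with D and D' the defect operators of W2 and
W2^*. The Julia operator (u, k) |-> (W2 u + D' k, D u - W2^* k) is isometric
([julia_isometry]), so the substitution q = D x2 - W2^* K x3 gives

  |x|^2 - |T x|^2 = |x1|^2 + |q|^2 + (|x3|^2 - |W3 x3|^2 - |K x3|^2)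
                    - |W1 x1 + L q + Z x3|^2,      Z = B + L W2^* K,

([rnorm_opmx3_defect]), where W2 only enters through q and Z. If T is a
contraction, D and D' are invertible because |W2| < 1 ([defect_inverse]), so L
and K exist and x1, q, x3 are independent. Hence T is a contraction iff the row
(W1, L, Z) is dominated by the positive form in front of it. Setting x1 = q = 0
gives |K y|^2 <= |y|^2 - |W3 y|^2, that is K = V2 D_{W3} ([douglas]). Setting
x3 = 0 says that (W1, L) is a contractive row, that is L = D_{W1^*} V1. Finally
the full row is dominated iff Z = E V3 F, where E^2 = Id - W1 W1^* - L L^* and
F^2 = Id - W3^* W3 - K^* K ([row_contractionP]); substituting L and K, these
are the two square roots in the formula for B. In the converse direction L, K
and Z are given in this form, and the identity shows that T is a contraction.

The operator theory behind this rests on two constructions. One variational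
argument ([relative_adjoint]) represents x |-> <S x, z> through D x whenever
|S x| <= c |D x|; it yields adjoints and the Douglas factorization together.
Square roots are limits of Y |-> (A + Y^2) / 2 ([sqrt_exists]); being limits of
polynomials in A they inherit the intertwining relations of A, which gives their
uniqueness and W2 D = D' W2. *)

Set Implicit Arguments.
Unset Strict Implicit.
Unset Printing Implicit Defensive.

(** * The underlying real Hilbert space *)

Section real_structure.
Context {R : realType}.
Implicit Types X H K : hilbertType R.

(** The real part of the inner product makes H a real Hilbert space with the
same norm. Norms and inner products then live in the totally ordered field R,
where linear and quadratic inequalities between them can be combined. *)
Definition rdot H (x y : H) : R := complex.Re '[x, y].
Definition rnorm H (x : H) : R := complex.Re `|x|.

Lemma normE H (x : H) : `|x| = (rnorm x)%:C%C.
Proof. by rewrite RRe_real// ger0_real. Qed.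

Lemma rnorm_ge0 H (x : H) : 0 <= rnorm x.
Proof. by rewrite -ler0c -normE. Qed.

Lemma rnorm0_eq0 H (x : H) : rnorm x = 0 -> x = 0.
Proof. by move=> x0; apply/normr0_eq0; rewrite normE x0. Qed.

Lemma rnormD H (x y : H) : rnorm (x + y) <= rnorm x + rnorm y.
Proof. by rewrite -lecR rmorphD/= -!normE ler_normD. Qed.

Lemma rnorm_scale H (a : R[i]) (x : H) :
  rnorm (a *: x) = complex.Re `|a| * rnorm x.
Proof.
by apply: complexI; rewrite -normE normrZ normE rmorphM/= RRe_real ?ger0_real.
Qed.

Lemma rnormZ H (t : R) (x : H) : rnorm (t%:C%C *: x) = `|t| * rnorm x.
Proof.
by rewrite rnorm_scale normc_def/= expr0n addr0 sqrtr_sqr.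
Qed.

Lemma rdotxx H (x : H) : rdot x x = rnorm x ^+ 2.
Proof. by apply: complexI; rewrite /rdot -inner_normE normE -rmorphXn. Qed.

Lemma rdotC H (x y : H) : rdot x y = rdot y x.
Proof. by rewrite /rdot hermC/= mul1r; case: (inner y x). Qed.

Lemma rdotDl H (x y z : H) : rdot (x + y) z = rdot x z + rdot y z.
Proof. by rewrite /rdot linearDl raddfD. Qed.

Lemma rdotNl H (x z : H) : rdot (- x) z = - rdot x z.
Proof. by rewrite /rdot linearNl raddfN. Qed.

Lemma rdotZl H (t : R) (x z : H) : rdot (t%:C%C *: x) z = t * rdot x z.
Proof.
rewrite /rdot linearZl_LR/=; case: (inner x z) => a b /=.
by rewrite mul0r subr0.
Qed.

Lemma rdotDr H (x y z : H) : rdot z (x + y) = rdot z x + rdot z y.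
Proof. by rewrite !(rdotC z) rdotDl. Qed.

Lemma rdotNr H (x z : H) : rdot z (- x) = - rdot z x.
Proof. by rewrite !(rdotC z) rdotNl. Qed.

Lemma rdotZr H (t : R) (x z : H) : rdot z (t%:C%C *: x) = t * rdot z x.
Proof. by rewrite !(rdotC z) rdotZl. Qed.

Definition rdotE := (rdotDl, rdotDr, rdotNl, rdotNr, rdotZl, rdotZr).

Lemma rnorm_sqrB H (x y : H) :
  rnorm (x - y) ^+ 2 = rnorm x ^+ 2 + rnorm y ^+ 2 - 2 * rdot x y.
Proof. by rewrite -!rdotxx !rdotE (rdotC y x); ring. Qed.

Lemma rnorm0 H : rnorm (0 : H) = 0.
Proof. by rewrite /rnorm normr0. Qed.

Lemma rdot0l H (x : H) : rdot 0 x = 0.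
Proof. by rewrite /rdot linear0l. Qed.

Lemma rdot0r H (x : H) : rdot x 0 = 0.
Proof. by rewrite rdotC rdot0l. Qed.

Lemma rnormN H (x : H) : rnorm (- x) = rnorm x.
Proof. by rewrite /rnorm normrN. Qed.

Lemma rdot_conjZ H (a : R[i]) (x y : H) : rdot (a *: x) y = rdot x (a^* *: y).
Proof. by rewrite /rdot linearZl_LR linearZr_LR/= conjCK. Qed.

Lemma rdot_conjZr H (a : R[i]) (x y : H) : rdot x (a *: y) = rdot (a^* *: x) y.
Proof. by rewrite rdot_conjZ conjCK. Qed.

(** Cauchy-Schwarz, from the expansion of | |y| x - |x| y |^2 >= 0. *)
Lemma rdot_le H (x y : H) : rdot x y <= rnorm x * rnorm y.
Proof.
have [/eqP|x0] := boolP (rnorm x * rnorm y == 0).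
  move/eqP; rewrite mulf_eq0 => /orP[] /eqP /[dup] /rnorm0_eq0 -> ->.
    by rewrite mul0r rdot0l.
  by rewrite mulr0 rdot0r.
have p0 : 0 < rnorm x * rnorm y by rewrite lt_def x0 mulr_ge0 ?rnorm_ge0.
have := sqr_ge0 (rnorm ((rnorm y)%:C%C *: x - (rnorm x)%:C%C *: y)).
rewrite -rdotxx !rdotE !rdotxx (rdotC y x).
nra.
Qed.

Lemma eq_rdot H (u v : H) : (forall x, rdot x u = rdot x v) -> u = v.
Proof.
move=> uv; apply/subr0_eq/rnorm0_eq0/eqP; rewrite -sqrf_eq0 -rdotxx.
by rewrite rdotDr rdotNr uv subrr.
Qed.

(** Evaluating the real identity at i x as well as at x recovers the imaginary
parts, since Re <i u, v> = - Im <u, v>. *)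
Lemma inner_rdot X H K (f : {linear X -> H}) (g : {linear X -> K}) u v x :
  (forall z, rdot (f z) u = rdot (g z) v) -> '[f x, u] = '[g x, v].
Proof.
move=> fg; apply/eqP; rewrite eq_complex; apply/andP; split; apply/eqP.
  exact: fg.
have := fg ('i%C *: x); rewrite !linearZ/= /rdot !linearZl_LR/=.
case: (inner (f x) u) => a b; case: (inner (g x) v) => c d /=.
by rewrite !mul0r !sub0r !mul1r => /oppr_inj.
Qed.

Lemma op_rbounded H K (T : 'B(H, K)) :
  exists2 M : R, 0 <= M & forall x, rnorm (T x) <= M * rnorm x.
Proof.
have [M M0 MT] := op_bound_ge0 T; have MR := RRe_real (ger0_real M0).
exists (complex.Re M) => [|x]; first by rewrite -ler0c MR.
by rewrite -lecR rmorphM/= MR -!normE.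
Qed.

Lemma opnorm_ge0 H K (T : 'B(H, K)) : 0 <= opnorm T.
Proof.
have [M M0 MT] := op_rbounded T.
apply: ub_le_sup; last by exists 0; rewrite /= ?linear0 normr0.
exists M => _ [z /= z1 <-]; rewrite (le_trans (MT z))// ler_piMr//.
by rewrite -lecR -normE.
Qed.

Lemma rnorm_opnorm H K (T : 'B(H, K)) (x : H) :
  rnorm (T x) <= opnorm T * rnorm x.
Proof.
have [M M0 MT] := op_rbounded T.
have [x0|x0] := eqVneq (rnorm x) 0.
  by rewrite (rnorm0_eq0 x0) linear0 !rnorm0 mulr0.
have xp : 0 < rnorm x by rewrite lt_def x0 rnorm_ge0.
rewrite -ler_pdivrMr// mulrC.
rewrite -[X in X * _]gtr0_norm ?invr_gt0// -rnormZ -linearZ.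
apply: ub_le_sup.
  exists M => _ [z /= z1 <-]; rewrite (le_trans (MT z))// ler_piMr//.
  by rewrite -lecR -normE.
exists ((rnorm x)^-1%:C%C *: x) => //=.
by rewrite normE rnormZ gtr0_norm ?invr_gt0// mulVf.
Qed.

Lemma contractionP H K (T : 'B(H, K)) :
  contraction_op T <-> forall x, rnorm (T x) <= rnorm x.
Proof.
split=> [T1 x|T1].
  by apply: le_trans (rnorm_opnorm T x) _; rewrite ler_piMl ?rnorm_ge0.
apply: ge_sup; first by exists (rnorm (T 0)), 0 => //=; rewrite normr0.
move=> _ [z /= z1 <-]; apply: le_trans (T1 z) _.
by rewrite -lecR -normE.
Qed.

End real_structure.

(** * Limits at a harmonic rate *)

Section completeness.
Context {R : realType}.
Implicit Types H K : hilbertType R.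

Lemma le0_harmonic (r C : R) : (forall n, r <= C / n.+1%:R) -> r <= 0.
Proof.
move=> rC; rewrite leNgt; apply/negP => r0.
have := rC (Num.truncn (C / r)); rewrite ler_pdivlMr ?ltr0n//.
have C0 : 0 <= C by move: (rC 0) r0; rewrite divr1; lra.
have := truncnS_gt (C / r); rewrite ltr_pdivrMr// mulrC.
lra.
Qed.

Lemma harmonic_eq H (x y : H) (C : R) :
  (forall n, rnorm (x - y) <= C / n.+1%:R) -> x = y.
Proof.
move=> /le0_harmonic xy; apply/subr0_eq/rnorm0_eq0/eqP.
by rewrite eq_le xy rnorm_ge0.
Qed.

(** An explicit rate instead of a bare Cauchy hypothesis: every limit taken
below then turns an identity into an inequality with error C / (n + 1), and
[le0_harmonic] and [harmonic_eq] conclude without filters. *)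
Lemma hilbert_cvg H (u : nat -> H) (C : R) :
  (forall n m, (n <= m)%N -> rnorm (u m - u n) <= C / n.+1%:R) ->
  exists v, forall n, rnorm (v - u n) <= C / n.+1%:R.
Proof.
move=> uC.
have C0 : 0 <= C.
  by have := uC 0 0 (leqnn _); rewrite divr1; apply: le_trans (rnorm_ge0 _).
have small (e : R[i]) : 0 < e -> exists n, (C / n.+1%:R)%:C%C < e.
  move=> e0; have eR := RRe_real (gtr0_real e0).
  have e1 : 0 < complex.Re e by rewrite -ltcR eR.
  exists (Num.truncn (C / complex.Re e)).
  rewrite -eR ltcR ltr_pdivrMr ?ltr0n// mulrC -ltr_pdivrMr//.
  exact: truncnS_gt.
have /cvg_ex[/= v uv] : cvgn u.
  apply: cauchy_cvg; apply/cauchyP => e e0; have [n ne] := small e e0.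
  exists (u n); exists n => //= m nm.
  rewrite -ball_normE/= distrC normE; apply: le_lt_trans ne.
  by rewrite lecR; exact: uC.
exists v => n; apply/ler_addgt0Pr => e e0.
have ec0 : 0 < e%:C%C by rewrite ltcR.
move/cvgrPdist_lt : uv => /(_ _ ec0) [N _ Nv].
have := Nv (maxn N n) (leq_maxl _ _); rewrite normE ltcR => /ltW vN.
rewrite -(subrK (u (maxn N n)) v) -addrA addrC.
apply: le_trans (rnormD _ _) _; apply: lerD => //.
exact: uC (leq_maxr _ _).
Qed.

End completeness.

(** * Riesz representation relative to an operator *)

Section relative_adjoint.
Context {R : realType}.
Implicit Types X H K : hilbertType R.

(** The vector v is obtained by minimizing J x = |D x|^2 - 2 Re <S x, z>, which
is bounded below because |S x| <= c |D x|. By the parallelogram law, the images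
under D of a minimizing sequence form a Cauchy sequence; v is its limit, and the
first-order condition at the minimum says that D x against v is S x against z.
For D the identity this is the Riesz representation theorem; in general v is the
representing vector in the closure of the range of D, although neither the
closure nor a projection onto it has to be built. *)
Lemma riesz_range X H K (D : 'B(X, H)) (S : 'B(X, K)) (c : R) (z : K) :
  (forall x, rnorm (S x) <= c * rnorm (D x)) ->
  exists v : H, (forall x, rdot (D x) v = rdot (S x) z) /\
    forall n : nat, exists x, rnorm (v - D x) <= 2 / n.+1%:R.
Proof.
move=> SD; pose J x := rnorm (D x) ^+ 2 - 2 * rdot (S x) z.
have JE x w (t : R) : J (x + t%:C%C *: w) =
    J x + 2 * t * (rdot (D x) (D w) - rdot (S w) z) + t ^+ 2 * rnorm (D w) ^+ 2.
  rewrite /J !linearD !linearZ/= -!rdotxx !rdotE (rdotC (D w) (D x)); ring.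
have [m mJ J_near] : exists2 m, (forall x, m <= J x) &
    forall n, exists x, J x < m + n.+1%:R^-1 ^+ 2.
  have J_lb : has_lbound (range J).
    exists (- (c * rnorm z) ^+ 2) => _ [x _ <-]; rewrite /J.
    have := rdot_le (S x) z.
    have := ler_wpM2r (rnorm_ge0 z) (SD x).
    have := sqr_ge0 (rnorm (D x) - c * rnorm z).
    nra.
  exists (inf (range J)) => [x|n]; first by apply: ge_inf => //; exists x.
  have [||_ [x _ <-] xm] := @inf_adherent _ (range J) (n.+1%:R^-1 ^+ 2).
  - by rewrite exprn_gt0// invr_gt0 ltr0n.
  - by split=> //; exists (J 0), 0.
  - by exists x.
have [u um] := choice J_near.
have [v uv] : exists v, forall n, rnorm (v - D (u n)) <= 2 / n.+1%:R.
  (* Parallelogram law: compare J at the midpoint of u n and u k with m. *)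
  apply: (hilbert_cvg (u := fun n => D (u n))) => n k nk.
  have n0 : 0 <= n.+1%:R^-1 :> R by rewrite invr_ge0.
  rewrite -ler_sqr ?nnegrE ?rnorm_ge0 ?mulr_ge0//.
  have := mJ (u n + (1 / 2)%:C%C *: (u k - u n)); rewrite JE.
  have := um n; have := um k.
  have : k.+1%:R^-1 ^+ 2 <= n.+1%:R^-1 ^+ 2 :> R.
    by rewrite ler_sqr ?nnegrE ?invr_ge0// lef_pV2 ?posrE ?ltr0n// ler_nat.
  rewrite /J !linearB/= -!rdotxx !rdotE (rdotC (D (u k)) (D (u n))).
  move: (D (u n)) (D (u k)) => p q.
  by move: k.+1%:R^-1 n.+1%:R^-1 => dk d; lra.
(* First-order condition: moving by - 1 / (n + 1) along w cannot bring J below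
   m, and J (u n) exceeds m by at most the square of that step. *)
have uvw w : rdot v (D w) - rdot (S w) z <= 0.
  apply: (@le0_harmonic _ _ (2 * rnorm (D w) + (1 + rnorm (D w) ^+ 2))) => n.
  set d := n.+1%:R^-1; have d0 : 0 < d by rewrite invr_gt0 ltr0n.
  have := ler_wpM2r (rnorm_ge0 (D w)) (uv n); rewrite -/d.
  have := rdot_le (v - D (u n)) (D w); rewrite rdotDl rdotNl.
  have := mJ (u n + (- d)%:C%C *: w); rewrite JE.
  have := um n; rewrite -/d.
  set g := rdot (D (u n)) (D w) - rdot (S w) z; set N := rnorm (D w).
  move=> h1 h2 h3 h4.
  have : 2 * g <= d * (1 + N ^+ 2).
    rewrite -(ler_pM2l d0); nra.
  rewrite /g => h5.
  have : 0 <= d * (1 + N ^+ 2).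
    by rewrite mulr_ge0 ?ltW// ltr_wpDr ?sqr_ge0.
  lra.
exists v; split=> [w|n]; last by exists (u n).
apply/eqP; rewrite rdotC -subr_eq0 eq_le uvw/=.
by have := uvw (- w); rewrite !linearN !rdotNl !rdotNr; lra.
Qed.

(** The common source of the adjoint (D the identity) and of the Douglas
factorization. Linearity of U comes from uniqueness: a vector that is orthogonal
to the range of D and also a limit of vectors of that range is zero. The
approximation of U z by vectors D x is what later allows an inequality known
on the range of D to be tested on U z itself. *)
Lemma relative_adjoint X H K (D : 'B(X, H)) (S : 'B(X, K)) (c : R) :
  0 <= c -> (forall x, rnorm (S x) <= c * rnorm (D x)) ->
  exists U : 'B(K, H),
    [/\ forall x z, '[D x, U z] = '[S x, z],
        forall z, rnorm (U z) <= c * rnorm z &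
        forall z (n : nat), exists x, rnorm (U z - D x) <= 2 / n.+1%:R].
Proof.
move=> c0 SD.
have [U /all_and2[DU U_near]] := choice (fun z => riesz_range z SD).
have orth w : (forall x, rdot (D x) w = 0) ->
    (forall e, 0 < e -> exists x, rnorm (w - D x) <= e) -> w = 0.
  move=> Dw w_near; apply/rnorm0_eq0/eqP; rewrite eq_le rnorm_ge0 andbT.
  rewrite leNgt; apply/negP => w0.
  have [x xw] := w_near (rnorm w / 2) (divr_gt0 w0 (ltr0Sn _ _)).
  have := rdot_le (w - D x) w; rewrite rdotDl rdotNl Dw rdotxx.
  nra.
have near_e z e : 0 < e -> exists x, rnorm (U z - D x) <= e.
  move=> e0; have [x xz] := U_near z (Num.truncn (2 / e)); exists x.
  apply: le_trans xz _; rewrite ler_pdivrMr ?ltr0n// mulrC -ler_pdivrMr//.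
  exact/ltW/truncnS_gt.
have U_lin : linear U.
  move=> a y z; apply/subr0_eq/orth => [x|e e0].
    rewrite rdotDr rdotNr !rdotDr !DU rdotDr !rdot_conjZr -!linearZ/= !DU.
    by rewrite subrr.
  pose r := complex.Re `|a|.
  have r0 : 0 <= r by rewrite -ler0c RRe_real ?ger0_real.
  have e3 : 0 < e / 3 by rewrite divr_gt0.
  have r1 : 0 < r + 1 by rewrite ltr_wpDl.
  have [x1 h1] := near_e (a *: y + z) _ e3.
  have [x2 h2] := near_e y _ (divr_gt0 e3 r1).
  have [x3 h3] := near_e z _ e3.
  exists (x1 - (a *: x2 + x3)).
  have -> : D (x1 - (a *: x2 + x3)) = D x1 - (a *: D x2 + D x3).
    by rewrite linearB linearP.
  rewrite [X in rnorm X](_ : _ =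
    (U (a *: y + z) - D x1) + - (a *: (U y - D x2)) + - (U z - D x3));
    last first.
    rewrite scalerBr !opprD !opprK !addrA.
    by rewrite [LHS](ACl (1*4*2*5*3*6)).
  apply: le_trans (rnormD _ _) _; rewrite rnormN.
  have := rnormD (U (a *: y + z) - D x1) (- (a *: (U y - D x2))).
  rewrite rnormN rnorm_scale -/r.
  rewrite ler_pdivlMr// in h2.
  have := rnorm_ge0 (U y - D x2).
  nra.
have U_bound z : rnorm (U z) <= c * rnorm z.
  have rr : rnorm (U z) ^+ 2 - c * rnorm z * rnorm (U z) <= 0.
    apply: (@le0_harmonic _ _ (2 * (rnorm (U z) + c * rnorm z))) => n.
    have [x xz] := U_near z n.
    have := rdot_le (U z - D x) (U z); rewrite rdotDl rdotNl DU rdotxx.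
    have := rdot_le (S x) z.
    have := ler_wpM2r (rnorm_ge0 z) (SD x).
    have := rnormD (D x - U z) (U z); rewrite subrK -opprB rnormN => Dx.
    have Dxc := ler_wpM2l c0 Dx; have := ler_wpM2r (rnorm_ge0 z) Dxc.
    have := ler_wpM2r (rnorm_ge0 (U z)) xz.
    have := ler_wpM2l (mulr_ge0 c0 (rnorm_ge0 z)) xz.
    by move: n.+1%:R^-1 => d; lra.
  have := rnorm_ge0 (U z); rewrite le_eqVlt => /predU1P[<-|r0].
    by rewrite mulr_ge0 ?rnorm_ge0.
  by rewrite -(ler_pM2r r0); move: rr; lra.
have [U' U'E] : exists U' : 'B(K, H), U' =1 U.
  have U_bd : exists M : R[i], forall z, `|U z| <= M * `|z|.
    by exists c%:C%C => z; rewrite !normE -rmorphM lecR.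
  by exists (BoundedOp U_lin U_bd).
exists U'; split=> [x z|z|z n].
- by apply: inner_rdot => w; rewrite U'E DU.
- by rewrite U'E.
- by have [x xz] := U_near z n; exists x; rewrite U'E.
Qed.

End relative_adjoint.

(** * Adjoints, Douglas factorization and positivity *)

Section adjoint.
Context {R : realType}.
Implicit Types X H K : hilbertType R.

Lemma adjointP H K (T : 'B(H, K)) x y : '[T x, y] = '[x, T^*o y].
Proof.
have [M M0 MT] := op_rbounded T.
have [S [TS _ _]] := relative_adjoint (D := op_id H) M0 MT.
have : [set S : 'B(K, H) | forall x y, '[T x, y] = '[x, S y]]%classic S
  by move=> ? ? /=; rewrite -TS.
by move=> /(xgetI 0); apply.
Qed.

Lemma rdot_adjoint H K (T : 'B(H, K)) x y : rdot (T x) y = rdot x (T^*o y).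
Proof. by rewrite /rdot adjointP. Qed.

Lemma rdot_adjointl H K (T : 'B(H, K)) x y : rdot (T^*o x) y = rdot x (T y).
Proof. by rewrite rdotC -rdot_adjoint rdotC. Qed.

Lemma adjoint_unique H K (T : 'B(H, K)) (S : 'B(K, H)) :
  (forall x y, rdot (T x) y = rdot x (S y)) -> T^*o = S.
Proof.
by move=> TS; apply: op_ext => y; apply: eq_rdot => x; rewrite -rdot_adjoint TS.
Qed.

Lemma adjointK H K (T : 'B(H, K)) : T^*o^*o = T.
Proof. by apply: adjoint_unique => x y; rewrite rdot_adjointl. Qed.

Lemma adjoint_le H K (T : 'B(H, K)) (c : R) : 0 <= c ->
  (forall x, rnorm (T x) <= c * rnorm x) ->
  forall y, rnorm (T^*o y) <= c * rnorm y.
Proof.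
move=> c0 Tc y; have := Tc (T^*o y).
have := rdot_le (T (T^*o y)) y; rewrite rdot_adjoint rdotxx.
have := rnorm_ge0 (T^*o y); rewrite le_eqVlt => /predU1P[<-|r0] h1 h2.
  by rewrite mulr_ge0 ?rnorm_ge0.
rewrite -(ler_pM2r r0).
have := ler_wpM2r (rnorm_ge0 y) h2; lra.
Qed.

(** The adjoint U^* of the relative adjoint extends D x |-> S x, which the
hypothesis makes well defined and bounded on the range of D. *)
Lemma douglas X H K (D : 'B(X, H)) (S : 'B(X, K)) (c : R) :
  0 <= c -> (forall x, rnorm (S x) <= c * rnorm (D x)) ->
  exists V : 'B(H, K), (forall h, rnorm (V h) <= c * rnorm h) /\ S = V *o D.
Proof.
move=> c0 /(relative_adjoint c0)[U [DU Uc _]].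
exists (U^*o); split; first exact: adjoint_le.
apply: op_ext => x /=; apply: eq_rdot => z.
by rewrite rdotC [RHS]rdotC rdot_adjointl /rdot DU.
Qed.

(** On a complex space a real quadratic form forces symmetry: polarizing
Re <i T x, x> = 0 at x + i y compares <T x, y> with <T y, x>. *)
Lemma positive_opP H (T : 'B(H)) :
  positive_op T <-> (forall x y, rdot (T x) y = rdot x (T y)) /\
                    forall x, 0 <= rdot (T x) x.
Proof.
split=> [T0|[Tsym T0] x].
  have Im0 x : rdot ('i%C *: T x) x = 0.
    have := T0 x; rewrite lecE/= => /andP[/eqP xi _].
    rewrite /rdot linearZl_LR/=; case: (inner (T x) x) xi => a b /= ->.
    by rewrite mul0r mulr0 subrr.
  split=> [x y|x]; last by have := T0 x; rewrite lecE/= => /andP[].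
  have := Im0 (x + 'i%C *: y).
  have := Im0 x; have := Im0 ('i%C *: y).
  rewrite linearD scalerDr !rdotE => -> ->; rewrite add0r addr0.
  rewrite linearZ/= !scalerA !rdot_conjZr scalerA.
  have -> : ('i%C : R[i])^* = - 'i%C.
    by apply/eqP; rewrite eq_complex/= oppr0 !eqxx.
  rewrite mulNr -expr2 sqr_i opprK scaleN1r scale1r rdotNl => /eqP.
  by rewrite addrC subr_eq0 => /eqP ->; rewrite rdotC.
rewrite lecE/= T0 andbT.
have : '[T x, x] = '[x, T x].
  by apply: (inner_rdot (f := T) (g := idfun)) => z; exact: Tsym.
rewrite [RHS]hermC/= mul1r; case: (inner (T x) x) => a b.
move=> /(congr1 (@complex.Im R))/= /eqP.
by rewrite -addr_eq0 -mulr2n mulrn_eq0/=.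
Qed.

End adjoint.

(** * Square roots of operators between 0 and the identity *)

Section sqrt.
Context {R : realType}.
Implicit Types H K : hilbertType R.

(** With A = Id - T, a positive S = Id - Y satisfies S^2 = T exactly when
Y = (A + Y^2) / 2. The iteration for Y starts at 0. *)
Fixpoint sqrt_approx H (A : H -> H) n x : H :=
  if n is n'.+1
  then (2^-1 : R)%:C%C *: (A x + sqrt_approx A n' (sqrt_approx A n' x))
  else 0.

(** The same iteration for the scalar A = 1; it dominates the operator one. *)
Fixpoint scalar_approx n : R :=
  if n is n'.+1 then 2^-1 * (1 + scalar_approx n' ^+ 2) else 0.

(** The gap p = 1 - q evolves by p |-> p - p^2 / 2, which preserves the bound
p <= 2 / (n + 2). *)
Lemma scalar_approx_bounds n :
  0 <= scalar_approx n <= 1 /\ 1 - scalar_approx n <= 2 / n.+2%:R.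
Proof.
elim: n => [|n [/andP[q0 q1] IH]] /=.
  by rewrite lexx ler01 subr0; split=> //; lra.
move: q0 q1 IH; set q := scalar_approx n => q0 q1 IH; split.
  by apply/andP; split; nra.
have n0 : 0 <= n%:R :> R by [].
have n2 : 0 < n.+2%:R :> R by rewrite ltr0n.
have n3 : 0 < n.+3%:R :> R by rewrite ltr0n.
move: IH; rewrite !ler_pdivlMr//.
rewrite -[n.+3]addn3 -[n.+2]addn2 !natrD; move: (n%:R : R) n0 => k n0 IH.
nra.
Qed.

Lemma sqrt_approx_intertwine H K (W : {linear H -> K}) (A : H -> H)
    (B : K -> K) :
  (forall x, W (A x) = B (W x)) ->
  forall n x, W (sqrt_approx A n x) = sqrt_approx B n (W x).
Proof.
move=> WA; elim=> [|n IH] x /=; first by rewrite linear0.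
by rewrite linearZ linearD/= WA !IH.
Qed.

Section approximation.
Variables (H : hilbertType R) (A : 'B(H)).
Hypothesis A1 : forall x, rnorm (A x) <= rnorm x.
Hypothesis Asym : forall x y, rdot (A x) y = rdot x (A y).
Local Notation Q := (sqrt_approx A).
Local Notation q := scalar_approx.

Lemma sqrt_approx_linear n : linear (Q n).
Proof.
elim: n => [|n IH] a x y /=; first by rewrite scaler0 addr0.
by rewrite linearP !IH addrACA -scalerDr [LHS]scalerDr !scalerA mulrC.
Qed.

Let QS n x : Q n.+1 x = (2^-1 : R)%:C%C *: (A x + Q n (Q n x)).
Proof. by []. Qed.

Let qS n : q n.+1 = 2^-1 * (1 + q n ^+ 2).
Proof. by []. Qed.

Let QB n x y : Q n (x - y) = Q n x - Q n y.
Proof. by rewrite -scaleN1r addrC sqrt_approx_linear scaleN1r addrC. Qed.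

Lemma sqrt_approx_le n x : rnorm (Q n x) <= q n * rnorm x.
Proof.
elim: n x => [|n IH] x /=; first by rewrite rnorm0 mul0r.
rewrite rnormZ ger0_norm ?invr_ge0// -mulrA ler_pM2l ?invr_gt0//.
have [/andP[q0 _] _] := scalar_approx_bounds n.
apply: le_trans (rnormD _ _) _; rewrite mulrDl mul1r lerD//.
by rewrite expr2 -mulrA (le_trans (IH _))// ler_wpM2l.
Qed.

(** Induction on Q_(n+1)^2 - Q_n^2 = Q_(n+1) (Q_(n+1) - Q_n) +
(Q_(n+1) - Q_n) Q_n, whose norm is at most the corresponding scalar
difference. *)
Lemma sqrt_approx_step n x :
  rnorm (Q n.+1 x - Q n x) <= (q n.+1 - q n) * rnorm x.
Proof.
elim: n x => [|n IH] x.
  rewrite /= !addr0 !subr0 rnormZ ger0_norm ?invr_ge0//.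
  by rewrite expr0n addr0 mulr1 ler_pM2l ?invr_gt0.
have [/andP[q0 _] _] := scalar_approx_bounds n.
have [/andP[q1 _] _] := scalar_approx_bounds n.+1.
have -> : Q n.+2 x - Q n.+1 x = (2^-1 : R)%:C%C *:
    (Q n.+1 (Q n.+1 x - Q n x) + (Q n.+1 (Q n x) - Q n (Q n x))).
  rewrite QB addrA subrK (QS n.+1) [X in _ - X](QS n).
  by rewrite -scalerBr [A x + _]addrC addrKA.
rewrite rnormZ ger0_norm ?invr_ge0//.
have -> : q n.+2 - q n.+1 =
    2^-1 * (q n.+1 * (q n.+1 - q n) + (q n.+1 - q n) * q n).
  rewrite (qS n.+1) [X in _ - X = _](qS n); ring.
rewrite -mulrA ler_pM2l ?invr_gt0//.
apply: le_trans (rnormD _ _) _; rewrite mulrDl lerD//.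
  by rewrite -mulrA (le_trans (sqrt_approx_le _ _))// ler_wpM2l.
rewrite (le_trans (IH _))// -mulrA ler_wpM2l ?sqrt_approx_le//.
by move=> /=; have := sqr_ge0 (q n - 1); lra.
Qed.

Lemma sqrt_approx_cauchy n m x : (n <= m)%N ->
  rnorm (Q m x - Q n x) <= 2 * rnorm x / n.+1%:R.
Proof.
move=> nm.
have qnm : rnorm (Q m x - Q n x) <= (q m - q n) * rnorm x.
  rewrite -(subnKC nm); elim: (m - n)%N => [|k IH].
    by rewrite addn0 !subrr rnorm0 mul0r.
  rewrite addnS -(subrKA (Q (n + k) x)) -(subrKA (q (n + k)%N)) mulrDl.
  by apply: le_trans (rnormD _ _) _; rewrite lerD// sqrt_approx_step.
apply: le_trans qnm _; rewrite mulrAC ler_wpM2r ?rnorm_ge0//.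
have [/andP[_ qm1] _] := scalar_approx_bounds m.
have [_] := scalar_approx_bounds n.
have : 2 / n.+2%:R <= 2 / n.+1%:R :> R.
  by rewrite ler_pM2l// lef_pV2 ?posrE ?ltr0n// ler_nat.
by move: n.+1%:R^-1 n.+2%:R^-1 => d d'; lra.
Qed.

Lemma sqrt_approx_sym n x y : rdot (Q n x) y = rdot x (Q n y).
Proof.
elim: n x y => [|n IH] x y /=.
  by rewrite rdot0l rdot0r.
by rewrite !rdotE Asym !IH.
Qed.

Lemma sqrt_approx_lim : exists2 Y : 'B(H),
  (forall n x, rnorm (Y x - Q n x) <= 2 * rnorm x / n.+1%:R) &
  [/\ forall x, rnorm (Y x) <= rnorm x,
      forall x y, rdot (Y x) y = rdot x (Y y) &
      forall x, Y x + Y x = A x + Y (Y x)].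
Proof.
have [Y YQ] := choice (fun x =>
  hilbert_cvg (u := fun n => Q n x) (fun n m => @sqrt_approx_cauchy n m x)).
have Y1 x : rnorm (Y x) <= rnorm x.
  rewrite -subr_le0; apply: (@le0_harmonic _ _ (2 * rnorm x)) => n.
  have := YQ x n; have := rnormD (Y x - Q n x) (Q n x); rewrite subrK.
  have [/andP[_ q1] _] := scalar_approx_bounds n.
  have := ler_wpM2r (rnorm_ge0 x) q1; have := sqrt_approx_le n x.
  by move: n.+1%:R^-1 => d; lra.
have Ylin : linear Y.
  move=> a x y.
  apply: (@harmonic_eq _ _ _ _ (2 * rnorm (a *: x + y) +
    complex.Re `|a| * (2 * rnorm x) + 2 * rnorm y)) => n.
  have -> : Y (a *: x + y) - (a *: Y x + Y y) =
      (Y (a *: x + y) - Q n (a *: x + y)) + - (a *: (Y x - Q n x))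
      + - (Y y - Q n y).
    rewrite sqrt_approx_linear scalerBr !opprD !opprK !addrA.
    by rewrite [RHS](ACl (1*4*6*(2*5)*(3*7)))/= addNr addNr !addr0.
  apply: le_trans (rnormD _ _) _; rewrite rnormN 2!mulrDl lerD//.
  apply: le_trans (rnormD _ _) _; rewrite rnormN rnorm_scale lerD//.
  rewrite -mulrA ler_wpM2l//.
  by rewrite -ler0c RRe_real ?ger0_real.
have [Yop YE] : exists Yop : 'B(H), Yop =1 Y.
  have Ybd : exists M : R[i], forall z, `|Y z| <= M * `|z|.
    by exists 1 => z; rewrite mul1r !normE lecR.
  by exists (BoundedOp Ylin Ybd).
exists Yop => [n x|]; first by rewrite YE; exact: YQ.
split=> [x|x y|x]; first by rewrite YE; exact: Y1.
- rewrite !YE; apply/eqP; rewrite -subr_eq0; apply/eqP/le_anti/andP.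
  have symle z w : rdot (Y z) w - rdot z (Y w) <= 0.
    apply: (@le0_harmonic _ _ (4 * rnorm z * rnorm w)) => n.
    have := rdot_le z (Q n w - Y w).
    rewrite -[in X in _ <= X]opprB rnormN !rdotE.
    have := rdot_le (Y z - Q n z) w; rewrite !rdotE sqrt_approx_sym.
    have := ler_wpM2r (rnorm_ge0 w) (YQ z n).
    have := ler_wpM2l (rnorm_ge0 z) (YQ w n).
    move: n.+1%:R^-1 => d; lra.
  split; first exact: symle.
  by have := symle y x; rewrite (rdotC (Y y)) (rdotC y); lra.
- rewrite !YE.
  apply: (@harmonic_eq _ _ _ _ (6 * rnorm x + 2 * rnorm (Y x))) => n.
  have -> : Y x + Y x - (A x + Y (Y x)) = (2%:R : R)%:C%C *: (Y x - Q n.+1 x)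
     + - ((Y (Y x) - Q n (Y x)) + Q n (Y x - Q n x)).
    have half2 : (2 : R)%:C%C * (2^-1 : R)%:C%C = 1.
      by rewrite -rmorphM/= divff ?pnatr_eq0.
    have -> : (2 : R)%:C%C = 2 by rewrite rmorph_nat.
    move: half2; rewrite rmorph_nat => half2.
    rewrite QB addrA subrK QS scalerBr scalerA half2 scale1r scaler_nat mulr2n.
    by rewrite !opprD !opprK !addrA [RHS](ACl (1*2*3*5*4*6))/= subrK.
  apply: le_trans (rnormD _ _) _; rewrite rnormN rnormZ.
  have := rnormD (Y (Y x) - Q n (Y x)) (Q n (Y x - Q n x)).
  have := sqrt_approx_le n (Y x - Q n x).
  have [/andP[_ q1] _] := scalar_approx_bounds n.
  have := ler_wpM2r (rnorm_ge0 (Y x - Q n x)) q1.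
  have := YQ x n; have := YQ (Y x) n; have := YQ x n.+1.
  rewrite ger0_norm//.
  have : 2 * rnorm x / n.+2%:R <= 2 * rnorm x / n.+1%:R.
    rewrite ler_wpM2l ?mulr_ge0 ?rnorm_ge0//.
    by rewrite lef_pV2 ?posrE ?ltr0n// ler_nat.
  move: n.+1%:R^-1 n.+2%:R^-1 => d d'; lra.
Qed.

End approximation.

(** Square roots will be compared through the iteration that they are limits of.
This passes every relation with T on to S, without any functional calculus. *)
Definition near_sqrt H (T S : 'B(H)) := forall n x,
  rnorm (x - S x - sqrt_approx ('Id - T) n x) <= 2 * rnorm x / n.+1%:R.

(** Each approximant is a polynomial in A = Id - T, so W intertwines the
approximants of T and T', hence their limits. *)
Lemma intertwine_near_sqrt H K (T S : 'B(H)) (T' S' : 'B(K)) (W : 'B(H, K)) :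
  near_sqrt T S -> near_sqrt T' S' ->
  W *o T = T' *o W -> W *o S = S' *o W.
Proof.
move=> TS TS' /(congr1 (@op_fun _ _ _)) WT; apply: op_ext => x /=.
have [M M0 MW] := op_rbounded W.
have WQ n : W (sqrt_approx ('Id - T) n x) = sqrt_approx ('Id - T') n (W x).
  apply: (sqrt_approx_intertwine (W := W)) => y /=.
  by rewrite linearB/=; congr (_ - _); exact: (congr1 (fun f => f y) WT).
apply: (@harmonic_eq _ _ _ _ (2 * rnorm (W x) + M * (2 * rnorm x))) => n.
have -> : W (S x) - S' (W x) =
    (W x - S' (W x) - sqrt_approx ('Id - T') n (W x))
    + - W (x - S x - sqrt_approx ('Id - T) n x).
  have -> : W (x - S x - sqrt_approx ('Id - T) n x) =
      W x - W (S x) - sqrt_approx ('Id - T') n (W x) by rewrite -WQ !linearB.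
  rewrite !opprD !opprK !addrA.
  by rewrite [RHS](ACl (5*2*(1*4)*(3*6)))/= subrr addNr !addr0.
apply: le_trans (rnormD _ _) _; rewrite rnormN mulrDl lerD//.
by rewrite (le_trans (MW _))// -mulrA ler_wpM2l.
Qed.

(** Positivity at y - d S y gives 2 |S y|^2 <= d <S (S y), S y>; let d tend
to 0. *)
Lemma positive_ker H (S : 'B(H)) y :
  positive_op S -> rdot (S y) y = 0 -> S y = 0.
Proof.
move=> /positive_opP[Ssym S0] Sy0; apply/rnorm0_eq0/eqP.
rewrite -sqrf_eq0 eq_le sqr_ge0 andbT -rdotxx -(pmulr_rle0 _ (ltr0Sn R 1)).
apply: (@le0_harmonic _ _ (rdot (S (S y)) (S y))) => n.
set d := n.+1%:R^-1; have d0 : 0 < d by rewrite invr_gt0 ltr0n.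
rewrite -(ler_pM2r d0); have := S0 (y - d%:C%C *: S y).
rewrite linearB linearZ/= !rdotE Sy0.
by rewrite (Ssym (S y) y); clearbody d; lra.
Qed.

(** S commutes with T = S^2, hence with its limit square root P. For
y = (S - P) x this gives (S + P) y = 0, so <S y, y> + <P y, y> = 0 with both
terms nonnegative; then S y = P y = 0 and |y|^2 = <x, (S - P) y> = 0. *)
Lemma sqrt_unique H (T S P : 'B(H)) : near_sqrt T P -> positive_op P ->
  positive_op S -> P *o P = T -> S *o S = T -> S = P.
Proof.
move=> TP P0 S0 PT ST.
have /(congr1 (@op_fun _ _ _)) SP : S *o P = P *o S.
  by apply: (intertwine_near_sqrt TP TP); rewrite -ST; apply: op_ext.
have SPE x : S (P x) = P (S x) by exact: (congr1 (fun f => f x) SP).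
have SS x : S (S x) = P (P x) by rewrite -[LHS]/((S *o S) x) ST -PT.
have [Ssym Sge0] := (positive_opP S).1 S0.
have [Psym Pge0] := (positive_opP P).1 P0.
apply: op_ext => x; apply/subr0_eq; set y := S x - P x.
have SPy : S y + P y = 0.
  by rewrite !linearB/= SPE SS addrA subrK subrr.
have := Sge0 y; have := Pge0 y.
have : rdot (S y) y + rdot (P y) y = 0.
  by rewrite -rdotDl SPy rdot0l.
move=> yy Py Sy.
have Sy0 : S y = 0 by apply: positive_ker => //; lra.
have Py0 : P y = 0 by apply: positive_ker => //; lra.
apply/rnorm0_eq0/eqP; rewrite -sqrf_eq0 -rdotxx {2}/y.
by rewrite rdotDr rdotNr -Ssym -Psym Sy0 Py0 subrr.
Qed.

Lemma sqrt_exists H (T : 'B(H)) : positive_op T -> positive_op ('Id - T) ->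
  exists S : 'B(H), [/\ positive_op S, S *o S = T & near_sqrt T S].
Proof.
move=> /positive_opP[Tsym T0] /positive_opP[Asym A0].
have A1 x : rnorm (('Id - T) x) <= rnorm x.
  rewrite -ler_sqr ?nnegrE ?rnorm_ge0// -!rdotxx /=.
  (* T A = A T, so T - T^2 = A T A + T A T is positive, where A = Id - T;
     hence A^2 = Id - T - (T - T^2) <= Id. *)
  have := T0 x; have := T0 (x - T x); have := A0 (T x).
  have := Tsym (T x) x.
  rewrite /= !linearB/= !rdotE (rdotC x (T x)); lra.
have [Y YQ [Y1 Ysym YE]] := sqrt_approx_lim A1 Asym.
exists ('Id - Y); split.
- apply/positive_opP; split=> [x y|x] /=; rewrite !rdotE; first by rewrite Ysym.
  have := rdot_le (Y x) x; have := ler_wpM2r (rnorm_ge0 x) (Y1 x).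
  by rewrite rdotxx; lra.
- apply: op_ext => x /=.
  have -> : Y (x - Y x) = Y x - Y (Y x) by rewrite linearB.
  apply/subr0_eq; rewrite opprD opprK !addrA (ACl (1*5*4*(2*3)))/= -opprD.
  by have := YE x; rewrite /= => <-; rewrite subrr.
- by move=> n x; rewrite [x - _](_ : _ = Y x) ?subKr//; exact: YQ.
Qed.

Lemma op_sqrtP H (T : 'B(H)) : positive_op T -> positive_op ('Id - T) ->
  [/\ positive_op (op_sqrt T), op_sqrt T *o op_sqrt T = T &
      near_sqrt T (op_sqrt T)].
Proof.
move=> T0 T1; have [S [S0 ST nS]] := sqrt_exists T0 T1.
have : (positive_op (op_sqrt T) /\ op_sqrt T *o op_sqrt T = T).
  apply: (xgetI 0 (x := S)
    (P := [set S | positive_op S /\ S *o S = T]%classic)).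
  by [].
move=> [P0 PT]; split=> //.
by rewrite (sqrt_unique nS S0 P0 ST PT).
Qed.

End sqrt.

(** * Defect operators *)

Section defect.
Context {R : realType}.
Implicit Types H K : hilbertType R.

(** The norm identity is how square roots enter the estimates; that they are
limits of the iteration is used in [defect_intertwine]. *)
Lemma op_sqrt_rnorm H (T : 'B(H)) :
  (forall x y, rdot (T x) y = rdot x (T y)) ->
  (forall x, 0 <= rdot (T x) x <= rnorm x ^+ 2) ->
  [/\ near_sqrt T (op_sqrt T),
      forall x y, rdot (op_sqrt T x) y = rdot x (op_sqrt T y) &
      forall x, rnorm (op_sqrt T x) ^+ 2 = rdot (T x) x].
Proof.
move=> Tsym T01.
have T0 : positive_op T by apply/positive_opP; split=> // x; case/andP: (T01 x).
have T1 : positive_op ('Id - T).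
  apply/positive_opP; split=> [x y|x] /=; rewrite !rdotE ?rdotxx.
    by rewrite Tsym.
  by rewrite subr_ge0; case/andP: (T01 x).
have [/positive_opP[Ssym _] /(congr1 (@op_fun _ _ _)) SS nS] := op_sqrtP T0 T1.
split=> // x; rewrite -rdotxx -Ssym; congr (rdot _ _).
exact: (congr1 (fun f => f x) SS).
Qed.

Section contraction.
Variables (H K : hilbertType R) (W : 'B(H, K)).
Hypothesis W1 : forall x, rnorm (W x) <= rnorm x.

Let gram_sym x y : rdot (('Id - W^*o *o W) x) y = rdot x (('Id - W^*o *o W) y).
Proof. by rewrite /= !rdotE rdot_adjointl rdot_adjoint. Qed.

Let gramE x : rdot (('Id - W^*o *o W) x) x = rnorm x ^+ 2 - rnorm (W x) ^+ 2.
Proof. by rewrite /= !rdotE rdot_adjointl !rdotxx. Qed.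

Let gram_bounds x : 0 <= rdot (('Id - W^*o *o W) x) x <= rnorm x ^+ 2.
Proof.
rewrite gramE subr_ge0 gerBl sqr_ge0 andbT.
by rewrite ler_sqr ?nnegrE ?rnorm_ge0.
Qed.

Lemma defect_sym x y : rdot (defect W x) y = rdot x (defect W y).
Proof. by have [_ ->] := op_sqrt_rnorm gram_sym gram_bounds. Qed.

Lemma rnorm_defect x :
  rnorm (defect W x) ^+ 2 = rnorm x ^+ 2 - rnorm (W x) ^+ 2.
Proof.
by have [_ _ ->] := op_sqrt_rnorm gram_sym gram_bounds; rewrite gramE.
Qed.

Lemma near_sqrt_defect : near_sqrt ('Id - W^*o *o W) (defect W).
Proof. by have [] := op_sqrt_rnorm gram_sym gram_bounds. Qed.

Section nested.
Variables (L : hilbertType R) (V : 'B(H, L)).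
Hypothesis V1 : forall x, rnorm (V x) <= rnorm x.
(* N = Id - W^* W - (V D_W)^* V D_W, the gap between the column (W, V D_W) and
   an isometry. *)
Let N := defect W *o ('Id - V^*o *o V) *o defect W.

Let NE x : rdot (N x) x =
  rnorm x ^+ 2 - rnorm (W x) ^+ 2 - rnorm (V (defect W x)) ^+ 2.
Proof.
by rewrite /N /= defect_sym !rdotE rdot_adjointl !rdotxx rnorm_defect.
Qed.

Let N_sym x y : rdot (N x) y = rdot x (N y).
Proof.
rewrite /N /= defect_sym -[RHS]defect_sym !rdotE.
by rewrite rdot_adjointl -rdot_adjoint.
Qed.

Let N_bounds x : 0 <= rdot (N x) x <= rnorm x ^+ 2.
Proof.
rewrite NE -rnorm_defect subr_ge0 ler_sqr ?nnegrE ?rnorm_ge0// V1/=.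
rewrite rnorm_defect; have := sqr_ge0 (rnorm (W x)).
have := sqr_ge0 (rnorm (V (defect W x))); lra.
Qed.

Lemma nested_defect_sym x y : rdot (op_sqrt N x) y = rdot x (op_sqrt N y).
Proof. by have [_ ->] := op_sqrt_rnorm N_sym N_bounds. Qed.

Lemma rnorm_nested_defect x : rnorm (op_sqrt N x) ^+ 2 =
  rnorm x ^+ 2 - rnorm (W x) ^+ 2 - rnorm (V (defect W x)) ^+ 2.
Proof. by have [_ _ ->] := op_sqrt_rnorm N_sym N_bounds; rewrite NE. Qed.

End nested.
End contraction.

Lemma contraction_adjoint H K (W : 'B(H, K)) :
  (forall x, rnorm (W x) <= rnorm x) -> forall y, rnorm (W^*o y) <= rnorm y.
Proof.
move=> W1 y; rewrite -[leRHS]mul1r; apply: adjoint_le => // x.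
by rewrite mul1r.
Qed.

(** W intertwines Id - W^* W with Id - W W^* , hence their square roots. *)
Lemma defect_intertwine H (W : 'B(H)) : (forall x, rnorm (W x) <= rnorm x) ->
  forall x, W (defect W x) = defect W^*o (W x).
Proof.
move=> W1 x; have W1' := contraction_adjoint W1.
have /(congr1 (@op_fun _ _ _)) WD : W *o defect W = defect W^*o *o W.
  apply: (intertwine_near_sqrt (near_sqrt_defect W1) (near_sqrt_defect W1')).
  by apply: op_ext => z; rewrite adjointK /= linearB.
exact: (congr1 (fun f => f x) WD).
Qed.

(** The two cross terms cancel because W D_W = D_{W^*} W; the map
(x, k) |-> (W x + D_{W^*} k, D_W x - W^* k) is the Julia operator of W. *)
Lemma julia_isometry H (W : 'B(H)) : (forall x, rnorm (W x) <= rnorm x) ->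
  forall x k, rnorm (W x + defect W^*o k) ^+ 2 +
    rnorm (defect W x - W^*o k) ^+ 2 = rnorm x ^+ 2 + rnorm k ^+ 2.
Proof.
move=> W1 x k; have W1' := contraction_adjoint W1.
have cross : rdot (W x) (defect W^*o k) = rdot (defect W x) (W^*o k).
  by rewrite -(defect_sym W1') -(defect_intertwine W1) rdot_adjoint.
have := rnorm_defect W1 x; have := rnorm_defect W1' k.
rewrite -!rdotxx !rdotE cross.
rewrite (rdotC (defect W^*o k) (W x)) (rdotC (W^*o k) (defect W x)) cross.
lra.
Qed.

(** A strict contraction has |D_W x|^2 >= (1 - c) |x|^2, so the identity factors
through D_W by [douglas]; the adjoint of this left inverse is a right inverse,
D_W being self-adjoint. *)
Lemma defect_inverse H K (W : 'B(H, K)) (c : R) : c < 1 ->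
  (forall x, rnorm (W x) <= c * rnorm x) ->
  exists E F : 'B(H),
    (forall x, E (defect W x) = x) /\ (forall x, defect W (F x) = x).
Proof.
move=> c1 Wc.
have W1 x : rnorm (W x) <= rnorm x.
  by rewrite (le_trans (Wc x))// ler_piMl ?rnorm_ge0// ltW.
have d0 : 0 < 1 - c by rewrite subr_gt0.
(* Any M with M^2 (1 - c) >= 1 would do; this one avoids a square root. *)
pose M := 1 + (1 - c)^-1.
have M0 : 0 <= M by rewrite addr_ge0// invr_ge0 ltW.
have DM x : rnorm (op_id H x) <= M * rnorm (defect W x).
  rewrite -ler_sqr ?nnegrE ?mulr_ge0 ?rnorm_ge0// exprMn (rnorm_defect W1) /=.
  have := Wc x; have := W1 x; have := rnorm_ge0 x; have := rnorm_ge0 (W x).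
  set a := rnorm x; set b := rnorm (W x) => b0 a0 ba bca.
  have Md : 1 <= M * (1 - c) by rewrite /M mulrDl mul1r mulVf ?gt_eqF//; lra.
  have MM : 1 <= M ^+ 2 * (1 - c).
    rewrite expr2 -mulrA (le_trans Md)// ler_peMl//; first exact: le_trans Md.
    by rewrite lerDl invr_ge0 ltW.
  have : (1 - c) * a ^+ 2 <= a ^+ 2 - b ^+ 2.
    by have := ler_wpM2r a0 bca; have := ler_wpM2r b0 ba; lra.
  move=> /(ler_wpM2l (sqr_ge0 M)); apply: le_trans.
  by rewrite mulrA ler_peMl ?sqr_ge0.
have [E [_ /(congr1 (@op_fun _ _ _)) ED]] := douglas M0 DM.
have EDx x : E (defect W x) = x by have /= <- := congr1 (fun f => f x) ED.
exists E, E^*o; split=> // x; apply: eq_rdot => z.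
by rewrite -(defect_sym W1) -rdot_adjoint EDx.
Qed.

End defect.

(** * Contractive rows *)

Section row.
Context {R : realType} (H1 H2 Y Y' K : hilbertType R).
Variables (F : 'B(H1, K)) (G : 'B(H2, K)) (E : 'B(K)).
Hypothesis Esym : forall x y, rdot (E x) y = rdot x (E y).
(** So E^2 = Id - F F^* - G G^*: E is the defect of the adjoint of the row
(F, G). *)
Hypothesis Enorm : forall h,
  rnorm (E h) ^+ 2 = rnorm h ^+ 2 - rnorm (F^*o h) ^+ 2 - rnorm (G^*o h) ^+ 2.

(** If the row (F, G, Z D^{-1}) is contractive, then its adjoint is, and the
third component U of that adjoint satisfies |U h|^2 <= |E h|^2, so U factors
through E. Here D^{-1} only makes sense through the relative adjoint U of Z,
with <D y, U h> = <Z y, h>, and U h is approximated by vectors D y.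
Conversely (F, G, E) is a coisometry, hence a contraction. *)
Lemma row_contractionP (D : 'B(Y, Y')) (Z : 'B(Y, K)) :
  (forall a b y, rnorm (F a + G b + Z y) ^+ 2 <=
                 rnorm a ^+ 2 + rnorm b ^+ 2 + rnorm (D y) ^+ 2) <->
  exists V : 'B(Y', K), (forall y, rnorm (V y) <= rnorm y) /\ Z = E *o V *o D.
Proof.
split=> [FGZ|[V [V1 ->]] a b y].
  have ZD y : rnorm (Z y) <= 1 * rnorm (D y).
    have := FGZ 0 0 y; rewrite !linear0 !add0r !rnorm0 expr0n !add0r mul1r.
    by rewrite ler_sqr ?nnegrE ?rnorm_ge0.
  have [U [DU _ U_near]] := relative_adjoint ler01 ZD.
  have UE h : rnorm (U h) <= 1 * rnorm (E h).
    rewrite mul1r -ler_sqr ?nnegrE ?rnorm_ge0// -subr_le0 Enorm.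
    apply: (@le0_harmonic _ _ 4) => n; have [y Uy] := U_near h n.
    have DUy : rdot (D y) (U h) = rdot (Z y) h by rewrite /rdot DU.
    (* Pairing r with h gives about |F^* h|^2 + |G^* h|^2 + |U h|^2 =: t, while
       |r|^2 is at most about t; so 2 t <= |r|^2 + |h|^2 yields t <= |h|^2. *)
    have := FGZ (F^*o h) (G^*o h) y; set r := F _ + G _ + Z y => r_le.
    have rh : rdot r h =
        rnorm (F^*o h) ^+ 2 + rnorm (G^*o h) ^+ 2 + rdot (D y) (U h).
      by rewrite /r !rdotDl (rdot_adjoint F) (rdot_adjoint G) !rdotxx DUy.
    have := sqr_ge0 (rnorm (r - h)); rewrite rnorm_sqrB.
    have := rnorm_sqrB (U h) (D y); rewrite (rdotC (U h)).
    have : rnorm (U h - D y) ^+ 2 <= 4 / n.+1%:R.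
      have n1 : n.+1%:R^-1 <= 1 :> R by rewrite invf_le1 ?ltr0n// ler1n.
      have n0 : 0 <= n.+1%:R^-1 :> R by rewrite invr_ge0.
      have := rnorm_ge0 (U h - D y); move: Uy n1 n0.
      by move: n.+1%:R^-1 (rnorm _) => d e; nra.
    by move: n.+1%:R^-1 => d; lra.
  have [V' [V'1 UV]] := douglas ler01 UE.
  exists (V'^*o); split.
    by apply: contraction_adjoint => x; rewrite -[leRHS]mul1r.
  apply: op_ext => y; apply: eq_rdot => h /=.
  rewrite rdotC [RHS]rdotC Esym rdot_adjointl -[V' (E h)]/((V' *o E) h) -UV.
  by rewrite /rdot DU.
rewrite /=; set w := V (D y); set r := F a + G b + E w.
have wD : rnorm w ^+ 2 <= rnorm (D y) ^+ 2.
  by rewrite ler_sqr ?nnegrE ?rnorm_ge0//; exact: V1.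
have rr : rnorm r ^+ 2 = rdot a (F^*o r) + rdot b (G^*o r) + rdot w (E r).
  by rewrite -rdotxx {1}/r !rdotDl (rdot_adjoint F) (rdot_adjoint G) Esym.
have young (H : hilbertType R) (x z : H) :
    2 * rdot x z <= rnorm x ^+ 2 + rnorm z ^+ 2.
  by have := sqr_ge0 (rnorm (x - z)); rewrite rnorm_sqrB; lra.
have := young _ a (F^*o r); have := young _ b (G^*o r); have := young _ w (E r).
have := Enorm r; lra.
Qed.

End row.

(** * Upper triangular contractions *)

Section triangular.
Context {R : realType}.
Implicit Types H K : hilbertType R.

Lemma rnorm_hsum H K (x : H \oplus K) :
  rnorm x ^+ 2 = rnorm x.1 ^+ 2 + rnorm x.2 ^+ 2.
Proof.
by apply: complexI; rewrite rmorphD !rmorphXn/= -!normE hsum_normE.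
Qed.

(** The Julia isometry of W2 maps (x2, K x3) to (W2 x2 + A2 x3, q) with
A2 = D_{W2^*} K, and A1 x2 = L D_{W2} x2 = L (q + W2^* K x3). Trading x2 for q
therefore absorbs the second row of the matrix, and what remains is one row
acting on x1, q and x3. *)
Lemma rnorm_opmx3_defect (H1 H2 H3 : hilbertType R)
    (W1 : 'B(H1)) (W2 : 'B(H2)) (W3 : 'B(H3)) (L : 'B(H2, H1))
    (K : 'B(H3, H2)) (B : 'B(H3, H1)) x1 x2 x3 q :
  (forall x, rnorm (W2 x) <= rnorm x) ->
  q = defect W2 x2 - W2^*o (K x3) ->
  rnorm ((x1, (x2, x3)) : H1 \oplus H2 \oplus H3) ^+ 2 -
  rnorm (opmx3 W1 (L *o defect W2) B 0 W2 (defect W2^*o *o K) 0 0 W3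
           (x1, (x2, x3))) ^+ 2 =
  rnorm x1 ^+ 2 + rnorm q ^+ 2 +
  (rnorm x3 ^+ 2 - rnorm (W3 x3) ^+ 2 - rnorm (K x3) ^+ 2) -
  rnorm (W1 x1 + L q + (B + L *o W2^*o *o K) x3) ^+ 2.
Proof.
move=> W21 qE; have := julia_isometry W21 x2 (K x3); rewrite -qE.
have -> : W1 x1 + L q + (B + L *o W2^*o *o K) x3 =
    W1 x1 + L (defect W2 x2) + B x3.
  by rewrite qE linearB/= !addrA [LHS](ACl (1*2*4*(3*5)))/= addNr addr0.
rewrite !rnorm_hsum /= !add0r; lra.
Qed.

End triangular.

Theorem theorem2p2 (R : realType) (H1 H2 H3 : hilbertType R)
    (W1 : 'B(H1)) (W2 : 'B(H2)) (W3 : 'B(H3))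
    (A1 : 'B(H2, H1)) (A2 : 'B(H3, H2)) (B : 'B(H3, H1))
    (hW1 : contraction_op W1) (hW2 : contraction_op W2) (hW3 : contraction_op W3)
    (hW2lt1 : opnorm W2 < 1) :
  let T : 'B(H1 \oplus H2 \oplus H3) := opmx3 W1 A1 B
                                              0  W2 A2
                                              0  0  W3 in
  contraction_op T <->
  exists (V1 : 'B(H2, H1)) (V2 : 'B(H3, H2)) (V3 : 'B(H3, H1)),
    [/\ contraction_op V1, contraction_op V2 & contraction_op V3] /\
    [/\ A1 = defect W1^*o *o V1 *o defect W2,
        A2 = defect W2^*o *o V2 *o defect W3
      & B = op_sqrt (defect W1^*o *o ('Id - V1 *o V1^*o) *o defect W1^*o)
              *o V3 *o
              op_sqrt (defect W3 *o ('Id - V2^*o *o V2) *o defect W3)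
            - defect W1^*o *o V1 *o W2^*o *o V2 *o defect W3].
Proof.
move=> T.
have W1c := (contractionP W1).1 hW1; have W1c' := contraction_adjoint W1c.
have W2c := (contractionP W2).1 hW2.
have W3c := (contractionP W3).1 hW3.
(* Once A1 and A2 are factored, T is contractive exactly when the remaining row
   is; its corner Z is then parametrized by V3. *)
have corner (V1 : 'B(H2, H1)) (V2 : 'B(H3, H2)) (Z : 'B(H3, H1)) :
    contraction_op V1 -> contraction_op V2 ->
  (forall a q y, rnorm (W1 a + (defect W1^*o *o V1) q + Z y) ^+ 2 <=
     rnorm a ^+ 2 + rnorm q ^+ 2 +
     (rnorm y ^+ 2 - rnorm (W3 y) ^+ 2 - rnorm ((V2 *o defect W3) y) ^+ 2)) <->
  exists V3 : 'B(H3, H1), contraction_op V3 /\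
    Z = op_sqrt (defect W1^*o *o ('Id - V1 *o V1^*o) *o defect W1^*o) *o V3 *o
        op_sqrt (defect W3 *o ('Id - V2^*o *o V2) *o defect W3).
  move=> /contractionP V1c /contractionP V2c.
  have V1c' := contraction_adjoint V1c.
  have GE : (defect W1^*o *o V1)^*o = V1^*o *o defect W1^*o.
    by apply: adjoint_unique => x y /=; rewrite (defect_sym W1c') rdot_adjoint.
  pose E := op_sqrt (defect W1^*o *o ('Id - V1^*o^*o *o V1^*o) *o defect W1^*o).
  have Enorm h : rnorm (E h) ^+ 2 = rnorm h ^+ 2 - rnorm (W1^*o h) ^+ 2 -
      rnorm ((defect W1^*o *o V1)^*o h) ^+ 2.
    by rewrite (rnorm_nested_defect W1c' V1c') GE.
  have rowP := row_contractionP (nested_defect_sym W1c' V1c') Enorm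
    (op_sqrt (defect W3 *o ('Id - V2^*o *o V2) *o defect W3)) Z.
  have <- : E = op_sqrt (defect W1^*o *o ('Id - V1 *o V1^*o) *o defect W1^*o).
    by rewrite /E adjointK.
  split=> [h|[V3 [/contractionP V3c ZE]] a q y].
    have [|V3 [V3c ZE]] := rowP.1.
      by move=> a q y; rewrite (rnorm_nested_defect W3c V2c); exact: h.
    by exists V3; split=> //; apply/contractionP.
  by rewrite -(rnorm_nested_defect W3c V2c); apply: rowP.2; exists V3.
split=> [/contractionP T1|].
  have [E [E' [ED DE]]] := defect_inverse hW2lt1 (rnorm_opnorm W2).
  have [_ [F [_ DF]]] := defect_inverse hW2lt1
    (adjoint_le (opnorm_ge0 W2) (rnorm_opnorm W2)).
  pose L := A1 *o E; pose K := F *o A2.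
  have A1E : A1 = L *o defect W2 by apply: op_ext => x /=; rewrite ED.
  have A2E : A2 = defect W2^*o *o K by apply: op_ext => x /=; rewrite DF.
  pose Z := B + L *o W2^*o *o K.
  have row a q y : rnorm (W1 a + L q + Z y) ^+ 2 <=
      rnorm a ^+ 2 + rnorm q ^+ 2 +
      (rnorm y ^+ 2 - rnorm (W3 y) ^+ 2 - rnorm (K y) ^+ 2).
    (* Invertibility of D_{W2} makes q an arbitrary vector. *)
    pose x2 := E' (q + W2^*o (K y)).
    have qE : q = defect W2 x2 - W2^*o (K y) by rewrite DE addrK.
    rewrite -subr_ge0 -(rnorm_opmx3_defect W1 W3 L B a W2c qE) -A1E -A2E.
    by rewrite subr_ge0 ler_sqr ?nnegrE ?rnorm_ge0//; exact: T1.
  have [V2 [V2c KE]] : exists V2 : 'B(H3, H2),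
      (forall y, rnorm (V2 y) <= 1 * rnorm y) /\ K = V2 *o defect W3.
    apply: douglas => // y; rewrite mul1r -ler_sqr ?nnegrE ?rnorm_ge0//.
    rewrite (rnorm_defect W3c) -subr_ge0.
    have := row 0 0 y; have := sqr_ge0 (rnorm (W1 0 + L 0 + Z y)).
    rewrite !rnorm0; lra.
  have [V1 [V1c LE]] : exists V1 : 'B(H2, H1),
      (forall y, rnorm (V1 y) <= rnorm y) /\ L = defect W1^*o *o V1 *o 'Id.
    have D1norm h : rnorm (defect W1^*o h) ^+ 2 =
        rnorm h ^+ 2 - rnorm (W1^*o h) ^+ 2 -
        rnorm ((0 : 'B(H2, H1))^*o h) ^+ 2.
      have -> : (0 : 'B(H2, H1))^*o = 0.
        by apply: adjoint_unique => x y; rewrite /= rdot0l rdot0r.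
      by rewrite (rnorm_defect W1c') rnorm0 expr0n subr0.
    apply: (row_contractionP (defect_sym W1c') D1norm 'Id L).1 => a b y /=.
    have := row a y 0; rewrite linear0 !addr0 !linear0 !rnorm0.
    move=> /le_trans; apply.
    have := sqr_ge0 (rnorm b); lra.
  have {}LE : L = defect W1^*o *o V1 by rewrite LE; apply: op_ext.
  have V1C : contraction_op V1 by apply/contractionP.
  have V2C : contraction_op V2.
    by apply/contractionP => y; rewrite -[leRHS]mul1r.
  have [V3 [V3C ZE]] : exists V3 : 'B(H3, H1), contraction_op V3 /\
      Z = op_sqrt (defect W1^*o *o ('Id - V1 *o V1^*o) *o defect W1^*o) *o V3 *o
          op_sqrt (defect W3 *o ('Id - V2^*o *o V2) *o defect W3).
    by apply/corner => // a q y; rewrite -LE -KE.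
  exists V1, V2, V3; split=> //; split.
  - by rewrite A1E LE.
  - by rewrite A2E KE; apply: op_ext.
  - by rewrite -ZE /Z LE KE; apply: op_ext => y /=; rewrite addrK.
move=> [V1 [V2 [V3 [[V1C V2C V3C] [A1E A2E BE]]]]].
pose K := V2 *o defect W3; pose L := defect W1^*o *o V1.
have ZE : B + L *o W2^*o *o K =
    op_sqrt (defect W1^*o *o ('Id - V1 *o V1^*o) *o defect W1^*o) *o V3 *o
    op_sqrt (defect W3 *o ('Id - V2^*o *o V2) *o defect W3).
  by rewrite BE; apply: op_ext => y /=; rewrite subrK.
have row := (corner V1 V2 _ V1C V2C).2 (ex_intro _ V3 (conj V3C ZE)).
apply/contractionP => -[x1 [x2 x3]].
rewrite -ler_sqr ?nnegrE ?rnorm_ge0// -subr_ge0.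
have A2E' : A2 = defect W2^*o *o K by rewrite A2E; apply: op_ext.
rewrite /T A1E A2E' (rnorm_opmx3_defect W1 W3 L B x1 W2c (erefl _)) subr_ge0.
exact: row.
Qed.
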